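(* Let $P_1,\ldots,P_n$ be $n$ different rational places of a function field $F$ over $\mathbb{F}_q$ and let $G$ be a divisor of $F$ with disjoint support with respect to $D=P_1+\cdots+P_n$. Suppose that there exists $\sigma\in\mathrm{Aut}_{D,G}(F)$ such that $$\sigma(P_1)=P_2,\ \ldots,\ \sigma(P_{n-1})=P_n,\ \sigma(P_n)=P_1.$$ Then $C_{\mathcal L}(D,G)$ is a cyclic AG-code, the order of $\sigma$ as an element of $\mathrm{Aut}_{\mathbb{F}_q}(F)$ is divisible by $n$, and $n$ is the smallest positive integer satisfying $\sigma^n(P_1)=P_1$.
   Context: A function field over $\mathbb{F}_q$ is a finite field extension of a rational function field $\mathbb{F}_q(x)$ having $\mathbb{F}_q$ as its full constant field. A rational place is a place of degree one. $\mathrm{Aut}_{\mathbb{F}_q}(F)$ is the group of automorphisms of $F$ fixing $\mathbb{F}_q$ pointwise; it acts on places by $\sigma(P)=\{\sigma(z):z\in P\}$ and on divisors by linearity. $\mathrm{Aut}_{D,G}(F)=\{\sigma\in\mathrm{Aut}_{\mathbb{F}_q}(F):\sigma(D)=D\text{ and }\sigma(G)=G\}$. The AG-code is $C_{\mathcal L}(D,G)=\{(z(P_1),\ldots,z(P_n))\in\mathbb{F}_q^n : z\in\mathcal{L}(G)\}$, where $z(P_i)$ is the residue class of $z$ modulo $P_i$ and $\mathcal{L}(G)=\{z\in F^*:(z)\ge -G\}\cup\{0\}$. A linear code $\mathcal{C}\subseteq\mathbb{F}_q^n$ is cyclic if $(c_1,\ldots,c_n)\in\mathcal{C}$ implies $(c_2,\ldots,c_n,c_1)\in\mathcal{C}$.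 *)

(* Defs.v *)
From HB Require Import structures.
From mathcomp Require Import all_boot all_order all_algebra all_field.
From mathcomp Require Import boolp classical_sets.
From mathcomp Require Import freeg.

Set Implicit Arguments.
Unset Strict Implicit.
Unset Printing Implicit Defensive.

Import GRing.Theory Num.Theory.

Local Open Scope ring_scope.
Local Open Scope classical_set_scope.

(* A function field over the finite field k is an F : fieldExtType k(x), where
   k(x) is ratfun k, satisfying full_constant_field. *)
Definition ratfun (k : finFieldType) : fieldType := {fraction {poly k}}.

Section FunctionField.
Variables (k : finFieldType) (F : fieldExtType (ratfun k)).

Definition cst (c : k) : F := (tofrac c%:P : ratfun k)%:A.

Fact cst_is_zmod_morphism : zmod_morphism cst.
Proof. by move=> a b; rewrite /cst !rmorphB /= scalerBl. Qed.

Fact cst_is_monoid_morphism : monoid_morphism cst.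
Proof.
by split=> [|a b]; rewrite /cst ?rmorph1 ?scale1r // !rmorphM /= -in_algE rmorphM.
Qed.

HB.instance Definition _ := GRing.isZmodMorphism.Build k F cst
  cst_is_zmod_morphism.
HB.instance Definition _ := GRing.isMonoidMorphism.Build k F cst
  cst_is_monoid_morphism.

Definition full_constant_field : Prop :=
  forall z : F, algebraicOver cst z -> exists c : k, z = cst c.

(* Valuation rings are proper subrings of F strictly containing k; at z = 0 the
   last clause uses 0^-1 = 0. *)
Record valuation_ring (O : set F) : Prop := ValuationRing {
  vring_cst : forall c, O (cst c);
  vring_sub : forall x y, O x -> O y -> O (x - y);
  vring_mul : forall x y, O x -> O y -> O (x * y);
  vring_not_cst : exists2 z, O z & forall c, z <> cst c;
  vring_proper : exists z, ~ O z;
  vring_total : forall z, O z \/ O z^-1 }.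

Record ideal_of (O I : set F) : Prop := IdealOf {
  ideal_sub : I `<=` O;
  ideal0 : I 0;
  idealB : forall x y, I x -> I y -> I (x - y);
  idealM : forall a x, O a -> I x -> I (a * x) }.

Record maximal_ideal_of (O P : set F) : Prop := MaximalIdealOf {
  maxideal_ideal : ideal_of O P;
  maxideal_proper : P <> O;
  maxideal_max : forall I, ideal_of O I -> P `<=` I -> I = P \/ I = O }.

Definition is_place (P : set F) : Prop :=
  exists2 O, valuation_ring O & maximal_ideal_of O P.

Record place := Place { place_set :> set F; placeP : is_place place_set }.

HB.instance Definition _ := gen_eqMixin place.
HB.instance Definition _ := gen_choiceMixin place.

Lemma place_inj : injective place_set.
Proof.
case=> P hP [Q hQ] /= PQ; rewrite PQ in hP *.
by rewrite (Prop_irrelevance hP hQ).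
Qed.

(* O_P, the (unique) valuation ring of which P is the maximal ideal *)
Definition place_ring (P : place) : set F :=
  [set z | exists O, [/\ valuation_ring O, maximal_ideal_of O P & O z]].

Definition place_unit (P : place) : set F :=
  [set u | [/\ u != 0, place_ring P u & place_ring P u^-1]].

Definition prime_element (P : place) : set F :=
  [set t | place_set P = [set t * z | z in place_ring P]].

(* v_P(z) for z != 0: the integer n such that z = t ^ n * u with t a prime
   element and u a unit at P. Only used for z != 0. *)
Definition valuation (P : place) (z : F) : int :=
  xget 0 [set n : int | exists t u,
    [/\ prime_element P t, place_unit P u & z = t ^ n * u]].

(* [O_P / P : k] = d, i.e. the classes modulo P of some b_0, ..., b_(d-1) in O_P
   form a k-basis of O_P / P *)
Definition place_degree (P : place) (d : nat) : Prop :=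
  exists b : 'I_d -> F, (forall i, place_ring P (b i)) /\
    forall z, place_ring P z ->
      exists! c : 'rV[k]_d, place_set P (z - \sum_i cst (c 0 i) * b i).

Definition rational_place (P : place) : Prop := place_degree P 1.

(* z(P), the residue class modulo P of z in O_P, as an element of
   k = O_P / P. Only used for P rational and z in O_P. *)
Definition residue (P : place) (z : F) : k :=
  xget 0 [set c | place_set P (z - cst c)].

Definition divisor := {freeg place / int}.

Definition disjoint_support (D E : divisor) : Prop :=
  forall P : place, P \in dom D -> P \notin dom E.

(* (z) >= - G is read at every place P: v_P(z) >= - G(P). *)
Definition riemann_roch_space (G : divisor) : set F :=
  [set z | z = 0 \/ (z != 0 /\ forall P, - coeff P G <= valuation P z)].

Definition AGcode n (P : 'I_n -> place) (G : divisor) : set 'rV[k]_n :=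
  [set \row_i residue (P i) z | z in riemann_roch_space G].

(* The group Aut_k(F); its elements fix k but need not fix k(x). *)
Record fqaut_spec (s : F -> F) : Prop := FqautSpec {
  fqaut_zmod : zmod_morphism s;
  fqaut_monoid : monoid_morphism s;
  fqaut_bij : bijective s;
  fqaut_cst : forall c, s (cst c) = cst c }.

Record fqaut := Fqaut { fqaut_fun :> F -> F; fqautP : fqaut_spec fqaut_fun }.

HB.instance Definition _ := gen_eqMixin fqaut.
HB.instance Definition _ := gen_choiceMixin fqaut.

HB.instance Definition _ (s : fqaut) :=
  GRing.isZmodMorphism.Build F F s (fqaut_zmod (fqautP s)).
HB.instance Definition _ (s : fqaut) :=
  GRing.isMonoidMorphism.Build F F s (fqaut_monoid (fqautP s)).

Lemma fqaut_ext (s t : fqaut) : s =1 t -> s = t.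
Proof.
case: s t => [s hs] [t ht] /= /funext st; rewrite st in hs *.
by rewrite (Prop_irrelevance hs ht).
Qed.

Fact fqaut_one_spec : fqaut_spec id.
Proof. by split=> //; exists id. Qed.

Fact fqaut_mul_spec (s t : fqaut) : fqaut_spec (s \o t).
Proof.
split=> [x y||| c] /=; first by rewrite !rmorphB.
- by split=> [|x y] /=; rewrite ?rmorph1 ?rmorphM.
- exact: bij_comp (fqaut_bij (fqautP s)) (fqaut_bij (fqautP t)).
- by rewrite !(fqaut_cst (fqautP _)).
Qed.

Fact fqaut_inv_ex (s : fqaut) : exists t : fqaut, cancel s t /\ cancel t s.
Proof.
have [g sK gK] := fqaut_bij (fqautP s).
have sI := can_inj sK; have sg z : s (g z) = z by exact: gK.
suff hg : fqaut_spec g by exists (Fqaut hg).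
split=> [x y||| c].
- by apply: sI; rewrite rmorphB /= !sg.
- split=> [|x y]; apply: sI; first by rewrite rmorph1 sg.
  by rewrite rmorphM /= !sg.
- by exists s.
- by apply: sI; rewrite sg (fqaut_cst (fqautP s)).
Qed.

Definition fqaut_one : fqaut := Fqaut fqaut_one_spec.
Definition fqaut_mul (s t : fqaut) : fqaut := Fqaut (fqaut_mul_spec s t).
Definition fqaut_inv (s : fqaut) : fqaut := projT1 (cid (fqaut_inv_ex s)).

Fact fqaut_mulA : associative fqaut_mul.
Proof. by move=> s t u; exact: fqaut_ext. Qed.
Fact fqaut_mul1 : left_id fqaut_one fqaut_mul.
Proof. by move=> s; exact: fqaut_ext. Qed.
Fact fqaut_mulr1 : right_id fqaut_one fqaut_mul.
Proof. by move=> s; exact: fqaut_ext. Qed.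
Fact fqaut_mulV : left_inverse fqaut_one fqaut_inv fqaut_mul.
Proof.
by move=> s; apply: fqaut_ext => z; case: (projT2 (cid (fqaut_inv_ex s))) => + _; exact.
Qed.
Fact fqaut_mulrV : right_inverse fqaut_one fqaut_inv fqaut_mul.
Proof.
by move=> s; apply: fqaut_ext => z; case: (projT2 (cid (fqaut_inv_ex s))) => _; exact.
Qed.

HB.instance Definition _ := isGroup.Build fqaut
  fqaut_mulA fqaut_mul1 fqaut_mulr1 fqaut_mulV fqaut_mulrV.

Fact fqaut_image_is_place (s : fqaut) (P : place) : is_place (s @` P).
Proof.
have [t [sK tK]] := fqaut_inv_ex s.
have tc c : t (cst c) = cst c by rewrite (fqaut_cst (fqautP t)).
have imE (A : set F) z : (s @` A) z <-> A (t z).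
  by split=> [[x Ax <-]|Az]; [rewrite sK | exists (t z)].
have [O [Oc Osub Omul [z0 Oz0 z0c] [z1 Oz1] Ot] [[PO P0 PB PM] PnO Pmax]]
  := placeP P.
exists (s @` O); split.
- by move=> c; apply/imE; rewrite tc.
- by move=> x y /imE Ox /imE Oy; apply/imE; rewrite rmorphB; exact: Osub.
- by move=> x y /imE Ox /imE Oy; apply/imE; rewrite rmorphM; exact: Omul.
- exists (s z0) => [|c /(congr1 t)]; first by apply/imE; rewrite sK.
  by rewrite sK tc; exact: z0c.
- by exists (s z1) => /imE; rewrite sK.
- by move=> z; case: (Ot (t z)) => h; [left|right]; apply/imE; rewrite ?fmorphV.
- split; first by move=> z /imE Pz; apply/imE/PO.
  + by apply/imE; rewrite rmorph0.
  + by move=> x y /imE Px /imE Py; apply/imE; rewrite rmorphB; exact: PB.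
  + by move=> a x /imE Oa /imE Px; apply/imE; rewrite rmorphM; exact: PM.
- move=> PO'; apply: PnO; apply/seteqP; split=> // z Oz.
  have : (s @` O) (s z) by exists z.
  by rewrite -PO' => /imE; rewrite sK.
- move=> I [IO I0 IB IM] PI.
  have [|z Pz|h|h] := Pmax [set z | I (s z)].
  + split=> [z /= Iz||x y /= Ix Iy|a x Oa /= Ix] /=.
    * by have /imE := IO _ Iz; rewrite sK.
    * by rewrite rmorph0.
    * by rewrite rmorphB; exact: IB.
    * by rewrite rmorphM; apply: IM => //; exists a.
  + by apply: PI; exists z.
  + left; apply/seteqP; split=> z => [Iz|/imE].
      by apply/imE; rewrite -h /= tK.
    by rewrite -h /= tK.
  + right; apply/seteqP; split=> z => [Iz|/imE].
      by apply/imE; rewrite -h /= tK.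
    by rewrite -h /= tK.
Qed.

Definition aut_place (s : fqaut) (P : place) : place :=
  Place (fqaut_image_is_place s P).

Definition aut_divisor (s : fqaut) (D : divisor) : divisor :=
  \sum_(P <- dom D) << coeff P D *g aut_place s P >>.

Definition autDG (D G : divisor) : set fqaut :=
  [set s | aut_divisor s D = D /\ aut_divisor s G = G].

End FunctionField.

Definition linear_code (k : finFieldType) n (C : set 'rV[k]_n) : Prop :=
  C 0 /\ forall (a : k) u v, C u -> C v -> C (a *: u + v).

(* ordS is the cyclic successor i |-> i + 1 mod n on 'I_n, so the second clause
   sends (c_1, ..., c_n) to (c_2, ..., c_n, c_1). *)
Definition cyclic_code (k : finFieldType) n (C : set 'rV[k]_n) : Prop :=
  linear_code C /\ forall c, C c -> C (\row_i c 0 (ordS i)).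

(* g has finite order m; the library's #[g] is for finite groups only. *)
Definition has_order (gT : groupType) (g : gT) (m : nat) : Prop :=
  [/\ (0 < m)%N, (g ^+ m)%g = 1%g &
      forall j, (0 < j)%N -> (g ^+ j)%g = 1%g -> (m <= j)%N].

(* Main.v *)
From HB Require Import structures.
Require Import Defs.
From mathcomp Require Import all_boot all_order all_algebra all_field.
From mathcomp Require Import boolp classical_sets.
From mathcomp Require Import freeg.

(** The code statement is invariance of the data under [s]: [s] maps [L(G)] to
    itself because [s(G) = G], and [z(s(P)) = (s^-1 z)(P)], so the shift of the
    codeword of [z] is the codeword of [s^-1 z].  Two facts about places are
    needed to make sense of this with [L(G)] and residues as they are defined
    here.  First, every place has a prime element [t] and every [z != 0] is a
    power of [t] times a unit; then [v_P(z) >= - G(P)] reads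
    [z * t ^ G(P) \in O_P], which is visibly linear and compatible with
    automorphisms ([riemann_roch_spaceP]).  Second, [z |-> z(P)] is linear on
    [O_P] for [P] rational ([residue_linear]).  Existence of prime elements
    ([vring_uniformizer]) comes from [k(X)]: an element [pi] generates the
    value group of [k(X)], and any [z != 0] of [F] has a power [z ^ e], with
    [0 < e <= N = [F : k(X)]], of the same value as a power of [pi], because
    the terms of an algebraic equation of [z] cannot all have distinct values.
    Hence [N! v(z)] is a multiple of [v(pi)], and the value group of [F] is
    infinite cyclic.

    As [s] permutes the [n] distinct places [P i] cyclically, [s ^ j] fixes
    the first one exactly when [n] divides [j]; this gives the last claim, and
    divisibility of the order of [s] once that order is known to be finite.

    Finiteness of the order ([fqaut_finite_order]) is a Northcott argument.
    For all [j], the element [s^j(X)] has degree at most [N] over [k(X)], and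
    [X] has degree at most [N] over [k(s^j(X))], the latter being the image
    under [s^j] of the former statement for [s^-j].  By Gauss's lemma the two
    equations can be replaced by a single nonzero one of bidegree at most
    [(N, N)] relating [X] and [s^j(X)] ([common_bidegree_bound]).  Over the
    finite field [k] there are finitely many such polynomials, so the orbit of
    [X] is finite and some power of [s] fixes [k(X)].  This power permutes
    the roots of the minimal polynomial over [k(X)] of each element of [F], so
    that its own powers eventually fix a basis of [F] over [k(X)]. *)

Set Implicit Arguments.
Unset Strict Implicit.
Unset Printing Implicit Defensive.

Import Order.TTheory GRing.Theory Num.Theory.

Local Open Scope ring_scope.
Local Open Scope classical_set_scope.

(** * Gauss's lemma and bidegrees of plane relations *)

Section Gauss.
Variable k : fieldType.
Implicit Types (p c : {poly k}) (f g h q : {poly {poly k}}).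

Lemma nonconstant_irreducible_factor c :
  (1 < size c)%N -> exists2 p, irreducible_poly p & p %| c.
Proof.
move=> c_gt1.
have ex : exists n, `[< exists p, [/\ (1 < size p)%N, p %| c & size p = n] >].
  by exists (size c); apply/asboolP; exists c.
case: (ex_minnP ex) => n /asboolP[p [p_gt1 pc <-]] min_p.
exists p => //; split=> // q q_neq1 qp.
rewrite -dvdp_size_eqp // eqn_leq dvdp_leq ?min_p //; last first.
  by rewrite -size_poly_gt0 ltnW.
apply/asboolP; exists q; split=> //; last exact: dvdp_trans pc.
have : q != 0 by apply: contraTneq qp => ->; rewrite dvd0p -size_poly_gt0 ltnW.
by rewrite -size_poly_gt0; case: size q_neq1 => [|[]].
Qed.

(** Gauss: reducing all coefficients modulo [p] gives representatives of [f] and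
    [g]; if both are nonzero, the product of their leading coefficients is a
    product of two polynomials of smaller size than the irreducible [p], hence
    prime to [p], and yet is the leading coefficient of a multiple of [p]. *)
Lemma irreducible_divides_coefs p f g h :
  irreducible_poly p -> p *: h = f * g ->
  (exists f', f = p *: f') \/ (exists g', g = p *: g').
Proof.
move=> p_irr phE; have p_gt1 := p_irr.1.
have p_neq0 : p != 0 by rewrite -size_poly_gt0 ltnW.
pose quo (u : {poly {poly k}}) := map_poly (fun a : {poly k} => a %/ p) u.
pose red (u : {poly {poly k}}) := map_poly (fun a : {poly k} => a %% p) u.
have divE u : u = p *: quo u + red u.
  apply/polyP=> i; rewrite coefD coefZ !coef_map_id0 ?div0p ?mod0p //.
  by rewrite mulrC -divp_eq.
have [f0|f_neq0] := eqVneq (red f) 0.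
  by left; exists (quo f); rewrite {1}(divE f) f0 addr0.
have [g0|g_neq0] := eqVneq (red g) 0.
  by right; exists (quo g); rewrite {1}(divE g) g0 addr0.
have red_coef u i : red u != 0 -> lead_coef (red u) = u`_i %% p ->
    ~~ (p %| lead_coef (red u)).
  move=> u0 uE; apply/negP => /dvdp_leq; rewrite lead_coef_eq0 u0 => /(_ isT).
  by rewrite leqNgt uE ltn_modp p_neq0.
have /negP[] : ~~ (p %| lead_coef (red f) * lead_coef (red g)).
  rewrite Gauss_dvdpr ?irreducible_poly_coprime //.
    by apply: red_coef => //; rewrite lead_coefE coef_map_id0 ?mod0p.
  by apply: red_coef => //; rewrite lead_coefE coef_map_id0 ?mod0p.
have redE u : red u = u - p *: quo u by rewrite {2}(divE u) addrC addKr.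
have redM : red f * red g = p *: (h - quo f * g - red f * quo g).
  rewrite [red g]redE mulrBr {1}redE mulrBl -phE -scalerAl -scalerAr.
  by rewrite -!scalerBr.
by rewrite -lead_coefM redM lead_coefZ dvdp_mulIl.
Qed.

Lemma sizeY_mul f g :
  f != 0 -> g != 0 -> sizeY (f * g) = (sizeY f + sizeY g).-1.
Proof. by move=> f0 g0; rewrite !sizeYE rmorphM size_mul ?swapXY_eq0. Qed.

Lemma sizeY_scale c f :
  c != 0 -> f != 0 -> sizeY (c *: f) = (size c + sizeY f).-1.
Proof.
move=> c0 f0; rewrite -mul_polyC sizeY_mul ?polyC_eq0 //.
by rewrite !sizeYE swapXY_polyC size_map_polyC.
Qed.

(** Each irreducible factor of [c] divides [q], by Gauss's lemma, and can be
    cancelled; when [c] is reduced to a constant, [h] divides [g] and the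
    degrees in the inner variable add up. *)
Lemma primitive_factor_sizeY h g q c :
    (forall p h', irreducible_poly p -> h <> p *: h') ->
    c != 0 -> g != 0 -> c *: g = q * h ->
  (sizeY h <= sizeY g)%N.
Proof.
move=> h_prim c0 g0; have [m] := ubnP (size c).
elim: m c c0 q => // m IHm c c0 q c_lt cgE.
have cg0 : c *: g != 0 by rewrite -mul_polyC mulf_neq0 ?polyC_eq0.
have /andP[q0 h0] : (q != 0) && (h != 0) by rewrite -negb_or -mulf_eq0 -cgE.
have [c_gt1|c_le1] := ltnP 1 (size c).
  have [p p_irr pc] := nonconstant_irreducible_factor c_gt1.
  have [c' cE] : exists c' : {poly k}, c = c' * p by exact/dvdpP.
  have p0 : p != 0 by rewrite -size_poly_gt0 ltnW ?p_irr.1.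
  have c'0 : c' != 0 by apply: contraNneq c0 => c'0; rewrite cE c'0 mul0r.
  have pcgE : p *: (c' *: g) = q * h by rewrite scalerA mulrC -cE.
  have [[q' qE]|[h' hE]] := irreducible_divides_coefs p_irr pcgE; last first.
    by case: (h_prim _ _ p_irr hE).
  apply: (IHm c' c'0 q').
    move: c_lt; rewrite cE size_mul //.
    case: (size p) p_irr.1 => [|[|n]] // _; rewrite !addnS !ltnS.
    by apply: leq_trans; rewrite ltnS leq_addr.
  apply: (@mulfI _ p%:P); first by rewrite polyC_eq0.
  by rewrite !mul_polyC pcgE qE scalerAl.
have c_eq1 : size c = 1 by apply/eqP; rewrite eqn_leq c_le1 size_poly_gt0.
have <- : sizeY (c *: g) = sizeY g by rewrite sizeY_scale // c_eq1.
rewrite cgE sizeY_mul //.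
have : (0 < sizeY q)%N by rewrite lt0n sizeY_eq0.
by case: (sizeY q) => // n _; rewrite addSn leq_addl.
Qed.

(** The kernel of [phi] meets the constants trivially, so it is generated up to
    scalars of [k[X]] by any of its elements [h] of least degree in the outer
    variable.  Taking such an [h] of least degree in the inner variable makes
    it primitive, and [primitive_factor_sizeY] applies to the
    pseudo-division of [g] by [h]. *)
Lemma common_bidegree_bound (L : idomainType)
    (phi : {rmorphism {poly {poly k}} -> L})
    (phi_inj : forall c, phi c%:P = 0 -> c = 0) f g :
    f != 0 -> phi f = 0 -> g != 0 -> phi g = 0 ->
  exists h, [/\ h != 0, phi h = 0, (size h <= size f)%N
             & (sizeY h <= sizeY g)%N].
Proof.
move=> f0 phif g0 phig.
pose K h := h != 0 /\ phi h = 0.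
have ex1 : exists n, `[< exists2 h, K h & size h = n >].
  by exists (size f); apply/asboolP; exists f.
case: (ex_minnP ex1) => r /asboolP[h1 Kh1 h1r] r_min.
have ex2 : exists n, `[< exists h, [/\ K h, size h = r & sizeY h = n] >].
  by exists (sizeY h1); apply/asboolP; exists h1.
case: (ex_minnP ex2) => d /asboolP[h [[h0 phih] hr hd]] d_min.
have phiZ c u : phi (c *: u) = phi c%:P * phi u by rewrite -mul_polyC rmorphM.
have r_le u : K u -> (r <= size u)%N.
  by move=> Ku; apply: r_min; apply/asboolP; exists u.
exists h; split=> //; first by rewrite hr r_le.
have lc0 e : lead_coef h ^+ e != 0 by rewrite expf_neq0 ?lead_coef_eq0.
apply: (@primitive_factor_sizeY h g (g %/ h) (lead_coef h ^+ scalp g h)) => //.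
  move=> p h' p_irr hE.
  have p0 : p != 0 by rewrite -size_poly_gt0 ltnW ?p_irr.1.
  have h'0 : h' != 0 by apply: contraNneq h0 => h'0; rewrite hE h'0 scaler0.
  have : (d <= sizeY h')%N.
    apply: d_min; apply/asboolP; exists h'; split=> //; last first.
      by rewrite -hr hE -mul_polyC size_Cmul.
    split=> //; have /eqP := phih; rewrite hE phiZ mulf_eq0.
    by case/orP => /eqP // /phi_inj /eqP; rewrite (negPf p0).
  rewrite leqNgt -hd hE sizeY_scale //.
  case: (size p) p_irr.1 => [|[|n]] // _.
  by rewrite !addSn /= ltnS leq_addl.
(* The remainder lies in the kernel of [phi] and is smaller than [h]. *)
have := Pdiv.Idomain.divp_eq g h.
have [->|rem0] := eqVneq (g %% h) 0; first by rewrite addr0.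
move=> /(congr1 phi);
  rewrite rmorphD rmorphM phiZ phig phih !mulr0 add0r => phir.
have := r_le (g %% h) (conj rem0 (esym phir)).
by rewrite leqNgt -hr ltn_modp h0.
Qed.

End Gauss.

(** * Automorphisms of a function field over a finite field have finite order *)

Section Fractions.
Local Open Scope quotient_scope.

Lemma fraction_numden (R : idomainType) (r : {fraction R}) :
  exists d e, d != 0 /\ tofrac d * r = tofrac e.
Proof.
elim/quotW: r => u; exists \d_u, \n_u; split; first exact: denom_ratioP.
rewrite /GRing.mul /= !piE; apply/eqmodP; rewrite /= FracField.equivfE.
by rewrite /FracField.mulf !numden_Ratio ?mul1r ?mulr1 ?oner_neq0 ?denom_ratioP.
Qed.

End Fractions.

(** The orbit of [z] has no more points than [p] has roots, and an injective map
    that ever returns to an orbit returns to its starting point. *)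
Lemma periodic_of_roots (L : idomainType) (s : L -> L) (p : {poly L}) (z : L) :
    injective s -> p != 0 -> (forall j, root p (iter j s z)) ->
  exists2 m, (0 < m)%N & iter m s z = z.
Proof.
move=> s_inj p0 p_root.
have iter_inj i : injective (iter i s)
  by elim: i => [|i IHi] // a b /s_inj /IHi.
have [n nE] : exists n, size p = n.+1.
  by exists (size p).-1; rewrite prednK // size_poly_gt0.
have : ~~ uniq (traject s z n.+1).
  apply/negP => tr_uniq.
  suff : (size (traject s z n.+1) < size p)%N by rewrite size_traject nE ltnn.
  by apply: max_poly_roots => //; apply/allP => _ /trajectP[i _ ->].
rewrite looping_uniq negbK => /trajectP[i lt_in].
rewrite -(subnKC (ltnW lt_in)) iterD => /iter_inj itE.
by exists (n - i)%N; rewrite // subn_gt0.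
Qed.

Section FunctionFieldAutomorphisms.
Variables (k : finFieldType) (F : fieldExtType (ratfun k)).
Implicit Types (s t : fqaut F) (f g h : {poly {poly k}}) (c : {poly k}).

(** The embedding of [k[X]] into [F]. *)
Definition polyF c : F := (tofrac c : ratfun k)%:A.

Definition varF : F := polyF 'X.

(** The value of [f(X, Z)] at [X = x], [Z = z]: the inner variable of
    [{poly {poly k}}] is [X], the outer one is [Z]. *)
Definition bieval (x z : F) f : F :=
  (map_poly (map_poly (@cst k F)) f).[z%:P].[x].

Fact bieval_is_zmod_morphism x z : zmod_morphism (bieval x z).
Proof. by move=> f g; rewrite /bieval rmorphB !hornerE. Qed.

Fact bieval_is_monoid_morphism x z : monoid_morphism (bieval x z).
Proof. by split=> [|f g]; rewrite /bieval ?rmorph1 ?rmorphM !hornerE. Qed.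

HB.instance Definition _ x z := GRing.isZmodMorphism.Build _ _ (bieval x z)
  (bieval_is_zmod_morphism x z).
HB.instance Definition _ x z := GRing.isMonoidMorphism.Build _ _ (bieval x z)
  (bieval_is_monoid_morphism x z).

Lemma polyF_is_zmod_morphism : zmod_morphism polyF.
Proof. by move=> a b; rewrite /polyF rmorphB scalerBl. Qed.

Lemma polyF_is_monoid_morphism : monoid_morphism polyF.
Proof.
by split=> [|a b]; rewrite /polyF ?rmorph1 ?scale1r // rmorphM -!in_algE
  rmorphM.
Qed.

HB.instance Definition _ := GRing.isZmodMorphism.Build _ _ polyF
  polyF_is_zmod_morphism.
HB.instance Definition _ := GRing.isMonoidMorphism.Build _ _ polyF
  polyF_is_monoid_morphism.

Lemma polyF_eq0 c : (polyF c == 0) = (c == 0).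
Proof. by rewrite /polyF -in_algE fmorph_eq0 tofrac_eq0. Qed.

Lemma polyFE c : polyF c = (map_poly (@cst k F) c).[varF].
Proof.
elim/poly_ind: c => [|c a IHc]; first by rewrite !rmorph0 horner0.
by rewrite rmorphD rmorphM /= IHc rmorphD rmorphM /= map_polyX map_polyC
  !hornerE.
Qed.

Lemma bieval_varF z f : bieval varF z f = (map_poly polyF f).[z].
Proof.
rewrite /bieval.
elim/poly_ind: f => [|f c IHf]; first by rewrite !rmorph0 !horner0.
rewrite !rmorphD !rmorphM /= !map_polyX !map_polyC /= !hornerE IHf.
by rewrite -polyFE.
Qed.

Lemma bieval_swapXY x z f : bieval z x (swapXY f) = bieval x z f.
Proof. by rewrite /bieval -swapXY_map horner2_swapXY. Qed.

Lemma fqaut_bieval s x z f : s (bieval x z f) = bieval (s x) (s z) f.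
Proof.
rewrite /bieval -(horner_map s) /=; congr _.[_].
rewrite -(horner_map (map_poly s)) /= map_polyC /=; congr _.[_].
rewrite -map_poly_comp; apply: eq_map_poly => c /=.
by rewrite -map_poly_comp; apply: eq_map_poly => a /=;
  rewrite (fqaut_cst (fqautP s)).
Qed.

Lemma clear_denominators (p : {poly ratfun k}) :
  exists c f, c != 0 /\ (tofrac c : ratfun k) *: p = map_poly (@tofrac _) f.
Proof.
elim/poly_ind: p => [|p r [c [f [c0 cfE]]]].
  by exists 1, 0; rewrite oner_neq0 scaler0 rmorph0.
have [d [e [d0 rE]]] := fraction_numden r.
exists (d * c), (d *: (f * 'X) + (c * e)%:P).
split; first by rewrite mulf_neq0.
have -> : map_poly (@tofrac _) (d *: (f * 'X) + (c * e)%:P) =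
    (tofrac d : ratfun k) *: (map_poly (@tofrac _) f * 'X) +
    (tofrac (c * e))%:P.
  by rewrite raddfD /= map_polyC /= map_polyZ /= rmorphM /= map_polyX.
rewrite -cfE scalerDr !tofracM -rE; congr (_ + _).
  by rewrite -scalerA -scalerAl.
by rewrite scale_polyC [tofrac c * _]mulrCA mulrA.
Qed.

(** This is the minimal polynomial of [z] over [k(X)], with denominators
    cleared. *)
Lemma annihilator_over_ratfun z :
  exists f, [/\ f != 0, bieval varF z f = 0 & (size f <= (\dim {:F}).+1)%N].
Proof.
have [q qE] := polyOver1P (minPolyOver 1%AS z).
have [c [f [c0 cfE]]] := clear_denominators q.
have fE : map_poly polyF f = polyF c *: minPoly 1%AS z.
  rewrite qE -[polyF c]/(in_alg F (tofrac c)) -map_polyZ cfE -map_poly_comp.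
  exact: eq_map_poly.
have pF0 : polyF c != 0 by rewrite polyF_eq0.
have sizefE : size f = size (minPoly 1%AS z).
  rewrite -(size_scale _ pF0) -fE size_map_inj_poly ?rmorph0 //.
  by apply/raddf_inj => a /eqP; rewrite polyF_eq0 => /eqP.
exists f; split.
- by rewrite -size_poly_eq0 sizefE size_minPoly.
- rewrite bieval_varF fE hornerZ.
  by have /rootP -> := root_minPoly 1%AS z; rewrite mulr0.
- by rewrite sizefE size_minPoly ltnS adjoin_degreeE dimv1 divn1 dimvS ?subvf.
Qed.

Definition poly_of_mx (n : nat) (A : 'M[k]_n.+1) : {poly {poly k}} :=
  \poly_(i < n.+1) \poly_(j < n.+1) A (inord i) (inord j).

Lemma poly_of_mx_surj n h :
  (size h <= n.+1)%N -> (sizeY h <= n.+1)%N -> exists A, h = @poly_of_mx n A.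
Proof.
move=> h_size h_sizeY; exists (\matrix_(i, j) h`_i`_j).
apply/polyP=> i; rewrite coef_poly; case: ltnP => [lt_in|le_ni]; last first.
  by rewrite nth_default // (leq_trans h_size).
apply/polyP=> j; rewrite coef_poly; case: ltnP => [lt_jn|le_nj].
  by rewrite mxE !inordK.
by rewrite nth_default // (leq_trans (max_size_coefXY _ _)) ?(leq_trans
  h_sizeY).
Qed.

Lemma iter_fqaut s i z : iter i s z = (s ^+ i)%g z.
Proof. by elim: i => // i IHi; rewrite iterS IHi expgS. Qed.

(** All elements [w] of the orbit of [X] are roots of one polynomial [p] over
    [F], the product of all [f(X, Z)] with [f != 0] of bidegree at most
    [(N, N)] over the finite field [k].  The bound in [Z] comes from the
    equation of [w] over [k(X)].  The bound in [X] comes from the equation over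
    [k(X)] of the preimage of [X]: transported by [s ^ j] it becomes an equation
    of [X] over [k(w)], in which the two variables have been exchanged. *)
Lemma fqaut_varF_periodic s : exists2 m, (0 < m)%N & iter m s varF = varF.
Proof.
set n := \dim {:F}.
pose p := \prod_(A : 'M[k]_n.+1 | poly_of_mx A != 0)
  map_poly polyF (poly_of_mx A).
have polyF_inj : injective polyF.
  by apply/raddf_inj => a /eqP; rewrite polyF_eq0 => /eqP.
apply: (@periodic_of_roots _ s p) => [||j]; first exact: fmorph_inj.
  apply/prodf_neq0 => A; apply: contraNneq => pA0.
  by rewrite -size_poly_eq0 -(size_map_inj_poly polyF_inj) ?rmorph0 ?pA0
    ?size_poly0.
set w := iter j s varF.
have [f [f0 fw fs]] := annihilator_over_ratfun w.
have [g [g0 gw gs]] := annihilator_over_ratfun ((s ^+ j)^-1%g varF).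
(* [s ^ j] turns the equation of the preimage [s^-j(X)] into one of [X]. *)
have gw' : bieval varF w (swapXY g) = 0.
  rewrite bieval_swapXY.
  have := congr1 (s ^+ j)%g gw; rewrite fqaut_bieval rmorph0.
  have -> : (s ^+ j)%g ((s ^+ j)^-1%g varF) = varF.
    by have /(congr1 (fun t : fqaut F => t varF)) := mulgV (s ^+ j)%g.
  by rewrite /w iter_fqaut.
have phi_inj (c : {poly k}) : bieval varF w c%:P = 0 -> c = 0.
  by rewrite bieval_varF map_polyC hornerC => /eqP; rewrite polyF_eq0 => /eqP.
have gY0 : swapXY g != 0 by rewrite swapXY_eq0.
have [h [h0 hw hs hsY]] := common_bidegree_bound phi_inj f0 fw gY0 gw'.
have hsY' : (sizeY h <= n.+1)%N.
  by rewrite (leq_trans hsY) // sizeYE swapXYK.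
have [A hA] := poly_of_mx_surj (leq_trans hs fs) hsY'.
rewrite /p (bigD1 A) /= -?hA // rootM; apply/orP; left.
by apply/rootP; rewrite -bieval_varF.
Qed.

Lemma fqaut_fix_polyF s c : s varF = varF -> s (polyF c) = polyF c.
Proof.
move=> sX; rewrite !polyFE -(horner_map s) /= sX -map_poly_comp.
by congr _.[_]; apply: eq_map_poly => a /=; rewrite (fqaut_cst (fqautP s)).
Qed.

Lemma fqaut_fix_in_alg s (r : ratfun k) : s varF = varF -> s r%:A = r%:A.
Proof.
move=> sX; have [d [e [d0 rE]]] := fraction_numden r.
have dF0 : polyF d != 0 by rewrite polyF_eq0.
have rFE : polyF d * r%:A = polyF e by rewrite /polyF -rE -!in_algE rmorphM.
apply: (mulfI dF0); rewrite -{1}(fqaut_fix_polyF d sX) -rmorphM rFE.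
exact: fqaut_fix_polyF.
Qed.

(** A power [t] of [s] fixes [k(X)], so each element of [F] has a finite orbit
    under [t], among the roots of its minimal polynomial over [k(X)]; a common
    multiple of the periods of a basis over [k(X)] is a period of [t]. *)
Lemma fqaut_finite_order s : exists2 m, (0 < m)%N & (s ^+ m)%g = 1%g.
Proof.
have [m m_gt0 smX] := fqaut_varF_periodic s.
pose t := (s ^+ m)%g; have tX : t varF = varF by rewrite /t -iter_fqaut.
have tjX j : (t ^+ j)%g varF = varF by rewrite -iter_fqaut iter_fix.
have t_per (z : F) : exists2 a, (0 < a)%N & iter a t z = z.
  have [q qE] := polyOver1P (minPolyOver 1%AS z).
  apply: (@periodic_of_roots _ t (minPoly 1%AS z)) => [||j].
  - exact: fmorph_inj.
  - by rewrite -size_poly_eq0 size_minPoly.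
  have /rootP z_root := root_minPoly 1%AS z.
  apply/rootP; rewrite iter_fqaut -(rmorph0 (t ^+ j)%g) -z_root -horner_map /=
    qE.
  congr _.[_]; rewrite -map_poly_comp; apply: eq_map_poly => r /=.
  by rewrite fqaut_fix_in_alg.
have [a a_gt0 ta] : exists2 a, (0 < a)%N &
    forall b, b \in (vbasis {:F} : seq F) -> iter a t b = b.
  elim: (vbasis {:F} : seq F) => [|b r [a a_gt0 IHa]]; first by exists 1%N.
  have [c c_gt0 tc] := t_per b; exists (a * c)%N;
    first by rewrite muln_gt0 a_gt0.
  move=> x; rewrite inE => /orP[/eqP->|xr]; first by rewrite iterM iter_fix.
  by rewrite mulnC iterM iter_fix ?IHa.
exists (m * a)%N; first by rewrite muln_gt0 m_gt0.
apply: fqaut_ext => z; rewrite expgnA -/t.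
rewrite (coord_vbasis (memvf z)) rmorph_sum; apply: eq_bigr => i _.
rewrite -mulr_algl rmorphM /= fqaut_fix_in_alg // -iter_fqaut ta //.
by apply: mem_nth; rewrite size_tuple.
Qed.

End FunctionFieldAutomorphisms.

(** * Valuation rings of a function field are discrete *)

Lemma cancel_scalars (L : fieldType) (a b x y p r : L) : a != 0 -> b != 0 ->
  (a * x) / (b * y) / ((a * p) / (b * r)) = x / y / (p / r).
Proof.
move=> a0 b0; have ab0 : a / b != 0 by rewrite mulf_neq0 ?invr_eq0.
rewrite -[a * x / _]mulf_div -[a * p / _]mulf_div [(a / b * _)^-1]invfM.
by rewrite mulrACA mulfV // mul1r.
Qed.

Section ValuationRing.
Variables (k : finFieldType) (F : fieldExtType (ratfun k)).
Variables (O : set F) (O_vring : valuation_ring O).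
Implicit Types (u x y z : F).

Definition vring_unit u : Prop := [/\ u != 0, O u & O u^-1].
Definition vring_nonunit x : Prop := O x /\ ~ vring_unit x.

Let Oc := vring_cst O_vring.
Let OB := vring_sub O_vring.
Let OM := vring_mul O_vring.

Lemma vring1 : O 1. Proof. by rewrite -(rmorph1 (@cst k F)); exact: Oc. Qed.
Lemma vring0 : O 0. Proof. by rewrite -(rmorph0 (@cst k F)); exact: Oc. Qed.
Lemma vringN x : O x -> O (- x).
Proof. by move=> Ox; rewrite -sub0r; apply: OB => //; exact: vring0. Qed.
Lemma vringD x y : O x -> O y -> O (x + y).
Proof. by move=> Ox Oy; rewrite -[y]opprK; apply: OB => //; exact: vringN. Qed.
Lemma vringX x (m : nat) : O x -> O (x ^+ m).
Proof. by move=> Ox; elim: m => [|m IH]; [exact: vring1|rewrite exprS;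
  exact: OM]. Qed.
Lemma vringV x : ~ O x -> O x^-1.
Proof. by case: (vring_total O_vring x). Qed.
Lemma vring_sum (I : Type) (r : seq I) (P : pred I) (f : I -> F) :
  (forall j, P j -> O (f j)) -> O (\sum_(j <- r | P j) f j).
Proof. by move=> Of; elim/big_ind: _ => //; [exact: vring0|exact: vringD]. Qed.

Lemma vring_unit_sub u : vring_unit u -> O u. Proof. by case. Qed.
Lemma vring_unit1 : vring_unit 1.
Proof. by split; rewrite ?invr1 ?oner_neq0 //; exact: vring1. Qed.
Lemma vring_unitV u : vring_unit u -> vring_unit u^-1.
Proof. by case=> u0 Ou Oui; split; rewrite ?invr_eq0 ?invrK. Qed.
Lemma vring_unitM u x : vring_unit u -> vring_unit x -> vring_unit (u * x).
Proof.
by case=> u0 Ou Oui [x0 Ox Oxi]; split; rewrite ?mulf_neq0 ?invfM //; exact: OM.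
Qed.
Lemma vring_unitXn u (m : nat) : vring_unit u -> vring_unit (u ^+ m).
Proof.
move=> Uu; elim: m => [|m IH]; first exact: vring_unit1.
by rewrite exprS; exact: vring_unitM.
Qed.
Lemma vring_unitXz u (n : int) : vring_unit u -> vring_unit (u ^ n).
Proof.
move=> Uu; case: n => m; first exact: vring_unitXn.
by rewrite NegzE -invr_expz; apply/vring_unitV/vring_unitXn.
Qed.
Lemma vring_unit_cst (a : k) : a != 0 -> vring_unit (cst F a).
Proof. by move=> a0; split; rewrite -?fmorphV ?fmorph_eq0 //; apply: Oc. Qed.

Lemma vring_nonunit0 : vring_nonunit 0.
Proof. by split; [exact: vring0|case; rewrite eqxx]. Qed.

Lemma vring_nonunitM x y : O x -> vring_nonunit y -> vring_nonunit (x * y).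
Proof.
move=> Ox [Oy NUy]; split=> [|[xy0 _ Oxyi]]; first exact: OM.
have /andP[x0 y0] : (x != 0) && (y != 0) by rewrite -negb_or -mulf_eq0.
apply: NUy; split=> //.
have -> : y^-1 = x * (x * y)^-1 by rewrite invfM mulrA mulfV // mul1r.
exact: OM.
Qed.

Lemma vring_nonunitB x y :
  vring_nonunit x -> vring_nonunit y -> vring_nonunit (x - y).
Proof.
move=> Nx Ny.
have [->|x0] := eqVneq x 0.
  rewrite sub0r -mulN1r; apply: vring_nonunitM => //.
  by apply: vringN; exact: vring1.
have [->|y0] := eqVneq y 0; first by rewrite subr0.
have [Oxy|/vringV Oyx] := EM (O (x / y)).
  have -> : x - y = (x / y - 1) * y by rewrite mulrBl divfK // mul1r.
  by apply: vring_nonunitM => //; apply: OB => //; exact: vring1.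
have -> : x - y = (1 - (x / y)^-1) * x
  by rewrite mulrBl invf_div divfK // mul1r.
by apply: vring_nonunitM => //; apply: OB => //; exact: vring1.
Qed.

Lemma vring_nonunitN x : vring_nonunit x -> vring_nonunit (- x).
Proof. by rewrite -sub0r; apply: vring_nonunitB; exact: vring_nonunit0. Qed.

Lemma vring_nonunit_sum (I : Type) (r : seq I) (P : pred I) (f : I -> F) :
  (forall j, P j -> vring_nonunit (f j)) ->
  vring_nonunit (\sum_(j <- r | P j) f j).
Proof.
move=> Nf; elim/big_ind: _ => //; first exact: vring_nonunit0.
by move=> x y Nx Ny; rewrite -[y]opprK; apply: vring_nonunitB => //;
  exact: vring_nonunitN.
Qed.

Lemma vring_unitD u x : vring_unit u -> vring_nonunit x -> vring_unit (u + x).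
Proof.
move=> Uu Nx; have [//|NUux] := EM (vring_unit (u + x)).
have Nux : vring_nonunit (u + x).
  by split=> //; apply: vringD; [exact: vring_unit_sub|case: Nx].
by have := vring_nonunitB Nux Nx; rewrite addrK => -[].
Qed.

Lemma vring_nonunitVr x : x != 0 -> ~ O x^-1 -> vring_nonunit x.
Proof.
move=> x0 NOxi; split; last by case.
by rewrite -[x]invrK; apply: vringV.
Qed.

Lemma maximal_ideal_nonunit (P : set F) :
  maximal_ideal_of O P -> P = vring_nonunit.
Proof.
move=> [[PO P0 PB PM] P_neqO P_max].
have P1 : ~ P 1.
  move=> P1; apply: P_neqO; apply/seteqP; split=> // z Oz.
  by rewrite -[z]mulr1; apply: PM.
have PN : P `<=` vring_nonunit.
  move=> z Pz; split; first exact: PO.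
  by case=> z0 Oz Ozi; apply: P1; rewrite -(mulVf z0); apply: PM.
have NI : ideal_of O vring_nonunit.
  split=> [z []//|||]; first exact: vring_nonunit0.
    exact: vring_nonunitB.
  exact: vring_nonunitM.
have [<-//|NO] := P_max vring_nonunit NI PN.
have := vring1; rewrite -NO => -[_ []]; exact: vring_unit1.
Qed.

(** If [z] is not in [O] then [z^-1] is, and dividing the equation
    by the power of [z] below the leading one expresses [z] as a sum of
    elements of [O]. *)
Lemma vring_integrally_closed (q : {poly F}) z :
  q \is monic -> (forall i : nat, O q`_i) -> root q z -> O z.
Proof.
move=> q_monic Oq /rootP qz0; apply/not_notP => NOz.
have z0 : z != 0 by apply: contra_notN NOz => /eqP ->; exact: vring0.
have Ozi := vringV NOz.
have [n nE] : exists n, size q = n.+1.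
  by exists (size q).-1; rewrite prednK // size_poly_gt0 monic_neq0.
have := qz0; rewrite horner_coef nE big_ord_recr /=.
have -> : q`_n = 1 by move/monicP: q_monic; rewrite lead_coefE nE.
case: n nE => [|m] nE.
  by rewrite big_ord0 add0r expr0 mulr1 => /eqP; rewrite oner_eq0.
rewrite mul1r addrC => /eqP; rewrite addr_eq0 => /eqP zmE.
apply: NOz.
have -> : z = z ^+ m.+1 * z ^- m by rewrite exprS mulfK ?expf_neq0.
rewrite zmE mulNr mulr_suml; apply: vringN; apply: vring_sum => i _.
rewrite -mulrA; apply: OM => //.
(* Multiplying by [z ^- m] leaves the powers [z ^ (i - m)], which are powers of
   [z^-1], on the right-hand side. *)
have zVE (a : nat) : (a <= m)%N -> z ^+ a * z ^- m = z^-1 ^+ (m - a).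
  move=> le_am; rewrite -{1}(subnK le_am) exprD invfM mulrCA.
  by rewrite mulfV ?expf_neq0 // mulr1 exprVn.
by rewrite zVE -1?ltnS //; exact: vringX.
Qed.

Lemma in_alg_quotient (r : ratfun k) : exists d e : {poly k},
  [/\ polyF F d != 0, r%:A = polyF F e / polyF F d :> F &
      (r != 0 -> polyF F e != 0)].
Proof.
have [d [e [d0 rE]]] := fraction_numden r; exists d, e.
have dF0 : polyF F d != 0 by rewrite polyF_eq0.
have rFE : r%:A = polyF F e / polyF F d :> F.
  apply: (canRL (mulfK dF0)).
  by rewrite mulrC /polyF -rE -!in_algE rmorphM.
split=> // r0; apply: contraNneq r0 => e0.
by move: rFE; rewrite e0 mul0r -in_algE => /eqP; rewrite fmorph_eq0.
Qed.

(** Otherwise [O] contains [k(X)], hence its integral closure, which is [F]. *)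
Lemma polyF_not_all_units :
  ~ (forall c : {poly k}, c != 0 -> vring_unit (polyF F c)).
Proof.
move=> U; have OK (r : ratfun k) : O r%:A.
  have [d [e [d0 -> _]]] := in_alg_quotient r.
  apply: OM; last by case: (U d); rewrite // -?(polyF_eq0 F).
  have [->|e0] := eqVneq e 0; first by rewrite rmorph0; exact: vring0.
  by case: (U e).
have [z []] := vring_proper O_vring.
apply: (@vring_integrally_closed (minPoly 1%AS z)); last exact: root_minPoly.
  exact: monic_minPoly.
have [q ->] := polyOver1P (minPolyOver 1%AS z).
by move=> i; rewrite coef_map /=; exact: OK.
Qed.

(** Discreteness of the trace of [O] on [k(X)].  If [X] is in [O] then [pi] is a
    polynomial of least degree among those that are not units of [O]: by
    division, a polynomial is a unit or a multiple of [pi].  Otherwise [O] is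
    the place at infinity of [k(X)] and [pi] is [X^-1]: a polynomial of degree
    [n] is [X ^ n] times a unit. *)
Lemma polyF_uniformizer : exists pi : F, [/\ pi != 0, vring_nonunit pi &
  forall c : {poly k}, c != 0 -> exists n, vring_unit (polyF F c * pi ^ n)].
Proof.
have [OX|NOX] := EM (O (varF F)).
  have OP (c : {poly k}) : O (polyF F c).
    elim/poly_ind: c => [|c a IHc]; first by rewrite rmorph0; exact: vring0.
    by rewrite rmorphD rmorphM; apply: vringD; [exact: OM|exact: Oc].
  have ex : exists n : nat,
      `[< exists2 c : {poly k},
            c != 0 /\ vring_nonunit (polyF F c) & size c = n >].
    apply/not_notP => nex; apply: polyF_not_all_units => c c0.
    apply/not_notP => NUc; apply: nex.
    by exists (size c); apply/asboolP; exists c.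
  case: (ex_minnP ex) => m /asboolP[p [p0 Np] pm] m_min.
  have small_unit (c : {poly k}) : c != 0 -> (size c < size p)%N ->
    vring_unit (polyF F c).
    move=> c0; rewrite pm ltnNge => /negP le_mc; apply/not_notP => NUc.
    by apply: le_mc; apply: m_min; apply/asboolP; exists c.
  exists (polyF F p); split; rewrite ?polyF_eq0 // => c.
  have [d] := ubnP (size c); elim: d c => // d IHd c c_lt c0.
  have [Uc|NUc] := EM (vring_unit (polyF F c)); first by exists 0;
    rewrite mulr1.
  (* A nonzero remainder is a unit by minimality of [p], but it is the
     difference of two non-units. *)
  have r0 : c %% p = 0.
    apply/eqP; apply/not_notP => /negP r0.
    have rE : polyF F (c %% p) = polyF F c - polyF F (c %/ p) * polyF F p.
      by rewrite {2}(divp_eq c p) rmorphD rmorphM addrC addKr.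
    have [] : vring_nonunit (polyF F (c %% p)).
      by rewrite rE; apply: vring_nonunitB; [|exact: vring_nonunitM].
    by move=> _ []; apply: small_unit => //; rewrite ltn_modp.
  have cE : c = (c %/ p) * p by rewrite {1}(divp_eq c p) r0 addr0.
  have a0 : c %/ p != 0 by apply: contraNneq c0 => a0; rewrite cE a0 mul0r.
  have p_gt1 : (1 < size p)%N.
    rewrite ltnNge; apply/negP => /size1_polyC pE; case: Np => _ [].
    rewrite pE; apply: vring_unit_cst.
    by apply: contraNneq p0 => p00; rewrite pE p00.
  have [|n Un] := IHd (c %/ p) _ a0.
    rewrite size_divp // (leq_trans _ (_ : size c <= d)%N) //.
    rewrite -subn_gt0 subKn; first by case: (size p) p_gt1 => [|[]].
    apply: leq_trans (leq_pred _) _.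
    rewrite leqNgt; apply/negP => lt_cp; apply: NUc; exact: small_unit.
  exists (n - 1); rewrite {1}cE rmorphM /= -mulrA.
  have pF0 : polyF F p != 0 by rewrite polyF_eq0.
  by rewrite -{1}[polyF F p]expr1z -expfzDr // addrCA subrr addr0.
have X0 : varF F != 0 by rewrite polyF_eq0 polyX_eq0.
have NXi : vring_nonunit (varF F)^-1.
  by apply: vring_nonunitVr; rewrite ?invr_eq0 ?invrK.
suff XP (c : {poly k}) : c != 0 ->
    exists n : nat, vring_unit (polyF F c * (varF F)^-1 ^+ n).
  exists (varF F)^-1; split; rewrite ?invr_eq0 // => c /XP[n Un].
  by exists n.
elim/poly_ind: c => [|c a IHc]; first by rewrite eqxx.
have [->|c0] := eqVneq c 0.
  rewrite mul0r add0r polyC_eq0 => a0; exists 0%N; rewrite mulr1.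
  exact: vring_unit_cst.
move=> _; have [n Un] := IHc c0; exists n.+1.
rewrite rmorphD rmorphM /= mulrDl -/(varF F) -mulrA [varF F * _]mulrC.
rewrite exprSr mulfVK //; apply: vring_unitD => //.
apply: vring_nonunitM => //; first exact: Oc.
by apply: vring_nonunitM => //; apply/vringX/(proj1 NXi).
Qed.

Lemma in_alg_uniformizer (pi : F) (r : ratfun k) :
    pi != 0 ->
    (forall c : {poly k}, c != 0 ->
      exists n : int, vring_unit (polyF F c * pi ^ n)) ->
  r != 0 -> exists n : int, vring_unit (r%:A * pi ^ n).
Proof.
move=> pi0 pi_unif r0; have [d [e [d0 rE /(_ r0) e0]]] := in_alg_quotient r.
rewrite !polyF_eq0 in d0 e0.
have [a Ua] := pi_unif d d0; have [b Ub] := pi_unif e e0.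
exists (b - a).
have -> : r%:A * pi ^ (b - a) = (polyF F e * pi ^ b) / (polyF F d * pi ^ a).
  by rewrite rE expfzDr // -invr_expz invfM mulrACA.
by apply: vring_unitM => //; exact: vring_unitV.
Qed.

(** Divisibility in [O] is a total preorder; [b] is an entry of least value. *)
Lemma vring_dominant (r : seq F) : has (fun a => a != 0) r ->
  exists b, [/\ b \in r, b != 0 & forall a, a \in r -> O (a / b)].
Proof.
elim: r => //= c r IHr cr0.
have [/IHr[b [br b0 Ob]]|r0] := boolP (has (fun a => a != 0) r); last first.
  have c0 : c != 0 by move: cr0; rewrite (negPf r0) orbF.
  exists c; split; rewrite ?mem_head // => a; rewrite inE => /orP[/eqP->|ar].
    by rewrite mulfV //; exact: vring1.
  by move/hasPn: r0 => /(_ a ar); rewrite negbK => /eqP->; rewrite mul0r;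
    exact: vring0.
have [Ocb|NOcb] := EM (O (c / b)).
  exists b; split; rewrite ?inE ?br ?orbT // => a;
    rewrite inE => /orP[/eqP->//|].
  exact: Ob.
have c0 : c != 0 by apply: contra_notN NOcb => /eqP->; rewrite mul0r;
  exact: vring0.
have Obc : O (b / c) by rewrite -invf_div; exact: vringV.
exists c; split; rewrite ?mem_head // => a; rewrite inE => /orP[/eqP->|ar].
  by rewrite mulfV //; exact: vring1.
have -> : a / c = (a / b) * (b / c) by rewrite mulrA divfK.
by apply: OM => //; exact: Ob.
Qed.

(** Strict triangle inequality: a sum with a single term of least value has that
    value, so it is not zero. *)
Lemma vring_sum0_unit_ratio m (f : 'I_m -> F) i0 :
    f i0 != 0 -> \sum_i f i = 0 ->
  exists i j : 'I_m, [/\ i != j, f i != 0, f j != 0 & vring_unit (f i / f j)].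
Proof.
move=> fi0 f_sum0.
have [|_ [/codomP[j ->] fj0 j_dom]] := @vring_dominant (codom f).
  by apply/hasP; exists (f i0); rewrite ?codom_f.
apply/not_notP => no_ratio.
have Nf i : i != j -> vring_nonunit (f i / f j).
  move=> ij; split; first by apply: j_dom; exact: codom_f.
  move=> Uij; apply: no_ratio; exists i, j; split=> //.
  by case: Uij => + _ _; apply: contraNneq => ->; rewrite mul0r.
have [_ []] : vring_nonunit (1 : F).
  rewrite -[1]opprK; apply: vring_nonunitN.
  have -> : -1 = \sum_(i | i != j) f i / f j.
    apply/eqP; rewrite eq_sym -subr_eq0 opprK; apply/eqP.
    rewrite -[1](mulfV fj0) addrC.
    rewrite -(bigD1 j (P := predT) (F := fun i => f i / f j)) //=.
    by rewrite -mulr_suml f_sum0 mul0r.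
  exact: vring_nonunit_sum.
exact: vring_unit1.
Qed.

(** Modulo the value group of [k(X)], the value of [z] has order at most
    [N = [F : k(X)]]: in the minimal equation of [z] over [k(X)], two terms have the same value,
    so that the power of [z] by which they differ has the value of an element
    of [k(X)]. *)
Lemma vring_torsion (pi z : F) :
    pi != 0 ->
    (forall c : {poly k}, c != 0 ->
      exists n : int, vring_unit (polyF F c * pi ^ n)) ->
  z != 0 -> exists e : nat, (0 < e <= \dim {:F})%N /\
    exists n : int, vring_unit (z ^+ e * pi ^ n).
Proof.
move=> pi0 pi_unif z0.
have [q qE] := polyOver1P (minPolyOver 1%AS z).
have qs : (size q <= (\dim {:F}).+1)%N.
  have <- : size (minPoly 1%AS z) = size q by rewrite qE size_map_poly.
  by rewrite size_minPoly ltnS adjoin_degreeE dimv1 divn1 dimvS ?subvf.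
have sq_gt0 : (0 < size q)%N.
  by rewrite -(size_map_poly (in_alg F)) -qE size_minPoly.
pose f (i : 'I_(size q)) : F := (q`_i)%:A * z ^+ i.
have lt_last : ((size q).-1 < size q)%N by rewrite prednK.
have [||i [j [ij fi0 fj0 Uij]]] := @vring_sum0_unit_ratio _ f (Ordinal lt_last).
- rewrite mulf_neq0 ?expf_neq0 //= -in_algE fmorph_eq0 -lead_coefE
  lead_coef_eq0.
  by rewrite -size_poly_gt0.
- have /rootP := root_minPoly 1%AS z;
  rewrite qE horner_coef size_map_poly => qz0.
  rewrite -[RHS]qz0; by apply: eq_bigr => i _; rewrite coef_map.
wlog lt_ji : i j ij fi0 fj0 Uij / (j < i)%N => [hwlog|].
  have [lt_ij|lt_ji|/val_inj ijE] := ltngtP i j; last by rewrite ijE eqxx in ij.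
    by apply: (hwlog j i); rewrite ?(eq_sym j) // -invf_div; exact: vring_unitV.
  exact: (hwlog i j).
exists (i - j)%N; rewrite subn_gt0 lt_ji; split.
  by rewrite (leq_trans (leq_subr _ _)) // -ltnS (leq_trans _ qs).
have qi0 : q`_i != 0 by apply: contraNneq fi0; rewrite /f => ->;
  rewrite scale0r mul0r.
have qj0 : q`_j != 0 by apply: contraNneq fj0; rewrite /f => ->;
  rewrite scale0r mul0r.
have [a Ua] := in_alg_uniformizer pi0 pi_unif qi0.
have [b Ub] := in_alg_uniformizer pi0 pi_unif qj0.
exists (b - a).
have -> : z ^+ (i - j) * pi ^ (b - a) =
    (f i / f j) / (((q`_i)%:A * pi ^ a) / ((q`_j)%:A * pi ^ b)).
  have A0 : in_alg F q`_i != 0 by rewrite fmorph_eq0; exact: qi0.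
  have B0 : in_alg F q`_j != 0 by rewrite fmorph_eq0; exact: qj0.
  rewrite /f -!in_algE; move: (in_alg F _) (in_alg F _) A0 B0 => A B A0 B0.
  rewrite cancel_scalars //.
  by rewrite expfB // invf_div expfzDr // invr_expz.
apply: vring_unitM => //; apply: vring_unitV; apply: vring_unitM => //.
exact: vring_unitV.
Qed.

Lemma vring_root x e : (0 < e)%N -> O (x ^+ e) -> O x.
Proof.
case: e => // e _ Oxe.
have [->|x0] := eqVneq x 0; first exact: vring0.
have [//|/vringV Oxi] := EM (O x).
have -> : x = x ^+ e.+1 * x^-1 ^+ e by rewrite exprVn exprS mulfK ?expf_neq0.
by apply: OM => //; exact: vringX.
Qed.

Lemma vring_nonunit_expz (pi : F) (n : int) :
  pi != 0 -> vring_nonunit pi -> O (pi ^ n) <-> 0 <= n.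
Proof.
move=> pi0 [Opi NUpi]; case: n => m; first by split=> // _; exact: vringX.
split=> // Opim; case: NUpi; split=> //.
have -> : pi^-1 = pi ^+ m * pi ^ (Negz m).
  by rewrite NegzE -invr_expz -exprnP exprS invfM mulrCA mulfV ?mulr1 //
    expf_neq0.
by apply: OM => //; exact: vringX.
Qed.

(** The exponents in [vring_torsion] divide [N!], so every [z ^+ N!] is a power
    of [pi] times a unit; the exponent of [pi] is [N!] times the value of [z]
    in units of [v(pi)]. *)
Lemma vring_valuation : exists v : F -> int,
  [/\ forall x y, x != 0 -> y != 0 -> v (x * y) = v x + v y,
      forall x, x != 0 -> O x <-> 0 <= v x &
      exists2 x, x != 0 & 0 < v x].
Proof.
have [pi [pi0 Npi pi_unif]] := polyF_uniformizer.
pose E := ((\dim {:F})`!)%N.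
have E_gt0 : (0 < E)%N by exact: fact_gt0.
pose V x (n : int) := vring_unit (x ^+ E * pi ^ (- n)).
have V_ex x : x != 0 -> exists n, V x n.
  move=> x0; have [e [/andP[e_gt0 e_le] [n Un]]] :=
    vring_torsion pi0 pi_unif x0.
  have /dvdnP[a aE] : (e %| E)%N by rewrite dvdn_fact // e_gt0.
  exists (- (n * a)); rewrite /V opprK aE mulnC exprM -exprz_exp -exprnP.
  rewrite -exprMn_comm; last exact: mulrC.
  exact: vring_unitXn.
have V_uniq x n m : V x n -> V x m -> n = m.
  move=> Vn Vm; have : vring_unit (pi ^ (m - n)).
    have x0 : x ^+ E != 0 by case: Vn => + _ _; rewrite mulf_eq0 => /norP[].
    have -> : pi ^ (m - n) = (x ^+ E * pi ^ (- n)) / (x ^+ E * pi ^ (- m)).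
      by rewrite -mulf_div mulfV // mul1r invr_expz opprK -expfzDr // addrC.
    by apply: vring_unitM => //; exact: vring_unitV.
  case=> _ /(vring_nonunit_expz _ pi0 Npi) nm.
  rewrite invr_expz => /(vring_nonunit_expz _ pi0 Npi) mn.
  by apply/eqP; rewrite eq_le -subr_ge0 nm -subr_ge0 -opprB mn.
pose v x := xget 0 [set n | V x n].
have vP x : x != 0 -> V x (v x) by move=> x0; exact: (xgetPex 0 (V_ex x x0)).
have VM x y n m : V x n -> V y m -> V (x * y) (n + m).
  move=> Vx Vy; rewrite /V exprMn opprD expfzDr // mulrACA.
  exact: vring_unitM.
(* [v x] is the exponent [n] of [V x n], so [v pi = N!]. *)
exists v; split.
- move=> x y x0 y0; apply: (V_uniq (x * y)); first by apply: vP;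
  rewrite mulf_neq0.
  by apply: VM; exact: vP.
- move=> x x0; have Vx := vP x x0.
  have xE : x ^+ E = (x ^+ E * pi ^ (- v x)) * pi ^ (v x).
    by rewrite -mulrA -expfzDr // addNr mulr1.
  have pE : pi ^ (v x) = (x ^+ E * pi ^ (- v x))^-1 * x ^+ E.
    by rewrite {2}xE mulKf //; case: Vx.
  split=> [Ox|v_ge0].
    apply/(vring_nonunit_expz _ pi0 Npi); rewrite pE.
    by apply: OM; [case: Vx|exact: vringX].
  apply: (vring_root E_gt0); rewrite xE; apply: OM; first by case: Vx.
  exact/vring_nonunit_expz.
exists pi => //; have <- : (E : int) = v pi; last by rewrite ltz_nat.
apply: (V_uniq pi); last exact: vP.
by rewrite /V -invr_expz -exprnP mulfV ?expf_neq0 //; exact: vring_unit1.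
Qed.

(** The values form a nonzero subgroup of the integers, generated by its least
    positive element, and [t] is any element of that value. *)
Lemma vring_uniformizer : exists t, [/\ t != 0, vring_nonunit t &
  forall z, z != 0 -> exists n : int, vring_unit (z * t ^ (- n))].
Proof.
have [v [vM vO [x x0 vx]]] := vring_valuation.
have v1 : v 1 = 0.
  by apply: (@addrI _ (v 1)); rewrite addr0 -vM ?oner_neq0 ?mulr1.
have vV y : y != 0 -> v y^-1 = - v y.
  move=> y0; apply/eqP; rewrite -addr_eq0 -vM ?invr_eq0 // mulVf //.
  by rewrite v1.
have vXn y (n : nat) : y != 0 -> v (y ^+ n) = n%:Z * v y.
  move=> y0; elim: n => [|n IHn]; first by rewrite v1 mul0r.
  by rewrite exprS vM ?expf_neq0 // IHn intS mulrDl mul1r.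
have vX y (n : int) : y != 0 -> v (y ^ n) = n * v y.
  move=> y0; case: n => n; first exact: vXn.
  by rewrite NegzE -invr_expz vV ?expf_neq0 // vXn // mulNr.
have ex : exists n : nat, `[< (0 < n)%N /\ exists2 y, y != 0 & v y = n >].
  exists `|v x|%N; apply/asboolP; split; first by rewrite absz_gt0 gt_eqF.
  by exists x => //; rewrite gtz0_abs.
case: (ex_minnP ex) => n /asboolP[n_gt0 [t t0 vt]] n_min.
exists t; split=> //.
  apply: vring_nonunitVr => // /vO; rewrite invr_eq0 vV // => /(_ t0).
  by rewrite vt oppr_ge0 lez_nat leqNgt n_gt0.
move=> z z0; exists (v z %/ v t)%Z.
set y := z * _; have y0 : y != 0 by rewrite mulf_neq0 ?expfz_neq0.
have vy : v y = (v z %% v t)%Z.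
  by rewrite vM ?expfz_neq0 // vX // mulNr /modz.
have vt0 : v t != 0 by rewrite vt; case: n n_gt0 {vt n_min}.
have vy_ge0 : 0 <= v y by rewrite vy modz_ge0.
have vy0 : v y = 0.
  apply/eqP; rewrite eq_le vy_ge0 andbT leNgt; apply/negP => vy_gt0.
  have : (n <= `|v y|)%N.
    apply: n_min; apply/asboolP; split; first by rewrite absz_gt0 gt_eqF.
    by exists y => //; rewrite gtz0_abs.
  by rewrite leqNgt -ltz_nat gtz0_abs // vy -vt ltz_pmod // vt ltz_nat.
by split=> //; apply/vO; rewrite ?invr_eq0 // ?vV // vy0.
Qed.

Lemma vring_unit_expz_sub (t u : F) (n : int) :
  t != 0 -> vring_nonunit t -> vring_unit u -> O (t ^ n * u) <-> 0 <= n.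
Proof.
move=> t0 Nt [u0 Ou Oui]; rewrite -(vring_nonunit_expz n t0 Nt).
split=> [Otu|Ot]; last exact: OM.
by rewrite -(mulfK u0 (t ^ n)); exact: OM.
Qed.

End ValuationRing.

(** * Places, Riemann-Roch spaces and residues under automorphisms *)

Section Places.
Variables (k : finFieldType) (F : fieldExtType (ratfun k)).
Implicit Types (P Q : place F) (s : fqaut F) (G : divisor F) (z t : F).

(** The place determines its valuation ring, which makes [place_ring]
    an actual valuation ring and not a mere union of such. *)
Lemma place_ringP P z : place_ring P z <-> (z = 0 \/ ~ place_set P z^-1).
Proof.
have memP (O : set F) : valuation_ring O -> maximal_ideal_of O P ->
    O z <-> (z = 0 \/ ~ place_set P z^-1).
  move=> OV OP; rewrite (maximal_ideal_nonunit OV OP); split=> [Oz|].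
    have [->|z0] := eqVneq z 0; first by left.
    by right=> -[Ozi] []; split; rewrite ?invr_eq0 ?invrK.
  case=> [->|NPzi]; first exact: vring0.
  apply/not_notP => NOz; apply: NPzi; split; first exact: vringV.
  by case=> _ _; rewrite invrK.
split=> [[O [OV OP]]|Pz]; first by move/(memP O OV OP).
by have [O OV OP] := placeP P; exists O; split=> //; apply/memP.
Qed.

Lemma place_ring_valuation P :
  valuation_ring (place_ring P) /\ maximal_ideal_of (place_ring P) P.
Proof.
have [O OV OP] := placeP P.
suff -> : place_ring P = O by [].
apply/seteqP; split=> z; last by move=> Oz; exists O.
move=> [O' [OV' OP' Oz']]; apply/not_notP => NOz.
have : vring_nonunit O' z^-1.
  rewrite -(maximal_ideal_nonunit OV' OP') (maximal_ideal_nonunit OV OP).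
  by split; [exact: vringV|case=> _ _; rewrite invrK].
case=> Ozi' []; split; rewrite ?invrK // invr_eq0.
by apply: contra_notN NOz => /eqP->; exact: vring0.
Qed.

Lemma place_nonunit P : place_set P = vring_nonunit (place_ring P).
Proof.
by have [OV OP] := place_ring_valuation P; exact: maximal_ideal_nonunit.
Qed.

Lemma prime_element_nonunit P t :
  prime_element P t -> t != 0 /\ vring_nonunit (place_ring P) t.
Proof.
move=> Pt; have [OV _] := place_ring_valuation P.
have [t' [t'0 Nt' _]] := vring_uniformizer OV.
have := Pt; rewrite /prime_element place_nonunit => PtE; split.
  have : vring_nonunit (place_ring P) t' by [].
  by rewrite PtE => -[z _ zE]; apply: contra_neq t'0 => t0;
    rewrite -zE t0 mul0r.
by rewrite PtE; exists 1; [exact: vring1|rewrite mulr1].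
Qed.

Definition generates_values P t : Prop :=
  forall z, z != 0 -> exists n : int, vring_unit (place_ring P) (z * t ^ (- n)).

Lemma generator_prime_element P t :
    t != 0 -> vring_nonunit (place_ring P) t -> generates_values P t ->
  prime_element P t.
Proof.
move=> t0 Nt t_gen; have [OV _] := place_ring_valuation P.
rewrite /prime_element place_nonunit; apply/seteqP; split=> z; last first.
  by case=> y Oy <-; rewrite mulrC; exact: vring_nonunitM.
move=> Nz; have [->|z0] := eqVneq z 0.
  by exists 0; rewrite ?mulr0 //; exact: vring0.
have [n Un] := t_gen z z0; exists (z / t); last by rewrite mulrC divfK.
have zE : z = t ^ n * (z * t ^ (- n)).
  by rewrite mulrCA -expfzDr // subrr mulr1.
have n_gt0 : 0 < n.
  rewrite lt_def; apply/andP; split; last first.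
    by apply/(vring_unit_expz_sub OV n t0 Nt Un); rewrite -zE; case: Nz.
  apply: contra_notN (proj2 Nz) => /eqP n0; move: Un.
  by rewrite n0 oppr0 mulr1.
have -> : z / t = t ^ (n - 1) * (z * t ^ (- n)).
  by rewrite {1}zE mulrAC expfzDr.
by apply/(vring_unit_expz_sub OV _ t0 Nt Un); rewrite subr_ge0 -gtz0_ge1.
Qed.

Lemma prime_element_exists P : exists t, prime_element P t.
Proof.
have [OV _] := place_ring_valuation P.
by have [t [t0 Nt t_gen]] := vring_uniformizer OV; exists t;
  exact: generator_prime_element.
Qed.

Lemma prime_element_associated P t t' :
    prime_element P t -> prime_element P t' ->
  exists2 a, vring_unit (place_ring P) a & t' = t * a.
Proof.
move=> Pt Pt'; have [t0 Nt] := prime_element_nonunit Pt.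
have [t'0 Nt'] := prime_element_nonunit Pt'.
have [a Oa aE] : [set t * z | z in place_ring P] t'
  by rewrite -Pt place_nonunit.
have [b Ob bE] : [set t' * z | z in place_ring P] t
  by rewrite -Pt' place_nonunit.
exists a => //; have ab1 : a * b = 1.
  by apply: (mulfI t0); rewrite mulrA aE bE mulr1.
have a0 : a != 0 by apply: contraNneq t'0 => a0; rewrite -aE a0 mulr0.
by split=> //; rewrite -[a^-1]mulr1 -ab1 mulKf.
Qed.

Lemma prime_element_generates_values P t :
  prime_element P t -> generates_values P t.
Proof.
move=> Pt z z0; have [OV _] := place_ring_valuation P.
have [t' [t'0 Nt' t'_gen]] := vring_uniformizer OV.
have Pt' := generator_prime_element t'0 Nt' t'_gen.
have [a Ua aE] := prime_element_associated Pt' Pt.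
have [n Un] := t'_gen z z0; exists n.
rewrite aE expfzMl mulrA; apply: vring_unitM => //; exact: vring_unitXz.
Qed.

(** Prime elements differ by units, so the exponent picked by [valuation],
    possibly for another prime element, is the exponent with respect to [t]. *)
Lemma valuation_geP P t z (m : int) : prime_element P t -> z != 0 ->
  m <= valuation P z <-> place_ring P (z * t ^ (- m)).
Proof.
move=> Pt z0; have [OV _] := place_ring_valuation P.
have [t0 Nt] := prime_element_nonunit Pt.
rewrite /valuation; set V := [set n : int | _].
have [n Un] := prime_element_generates_values Pt z0.
have /(xgetPex 0)[t' [u [Pt' Uu zE]]] : exists n, V n.
  exists n, t, (z * t ^ (- n)); split=> //.
  by rewrite mulrCA -expfzDr // subrr mulr1.
have [a Ua aE] := prime_element_associated Pt Pt'.
move: zE; set v := xget _ _ => zE.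
have -> : z * t ^ (- m) = t ^ (v - m) * (a ^ v * u).
  rewrite zE aE expfzMl expfzDr // -!mulrA; congr (_ * _).
  by rewrite [RHS]mulrC -mulrA.
rewrite (vring_unit_expz_sub OV) // ?subr_ge0 //.
by apply: vring_unitM => //; exact: vring_unitXz.
Qed.

(** In this form membership is closed under linear combinations and transported
    by automorphisms, with no case distinction at [z = 0]. *)
Lemma riemann_roch_spaceP G z : riemann_roch_space G z <->
  (forall P t, prime_element P t -> place_ring P (z * t ^ (coeff P G))).
Proof.
split=> [[->|[z0 Gz]] P t Pt|Gz].
- by rewrite mul0r; have [OV _] := place_ring_valuation P; exact: vring0.
- by have /(valuation_geP _ Pt z0) := Gz P; rewrite opprK.
have [->|z0] := eqVneq z 0; first by left.
right; split=> // P; have [t Pt] := prime_element_exists P.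
by apply/(valuation_geP _ Pt z0); rewrite opprK; exact: Gz.
Qed.

Lemma riemann_roch_space_linear G (a : k) z w :
  riemann_roch_space G z -> riemann_roch_space G w ->
  riemann_roch_space G (cst F a * z + w).
Proof.
move=> /riemann_roch_spaceP Gz /riemann_roch_spaceP Gw.
apply/riemann_roch_spaceP => P t Pt; have [OV _] := place_ring_valuation P.
rewrite mulrDl -mulrA; apply: vringD => //; last exact: Gw.
by apply: (vring_mul OV); [exact: vring_cst OV _|exact: Gz].
Qed.

Lemma aut_place_mem s P z : place_set (aut_place s P) (s z) <-> place_set P z.
Proof.
split=> [[y Py /fmorph_inj <-] //|Pz]; by exists z.
Qed.

Lemma aut_place_inj s : injective (aut_place s).
Proof.
move=> P Q sPQ; apply: place_inj; apply/seteqP; split=> z.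
  by move/(aut_place_mem s); rewrite sPQ => /aut_place_mem.
by move/(aut_place_mem s); rewrite -sPQ => /aut_place_mem.
Qed.

Lemma aut_place_ring s P z :
  place_ring (aut_place s P) (s z) <-> place_ring P z.
Proof.
rewrite !place_ringP -fmorphV aut_place_mem; split=> -[z0|]; try by right.
  by left; apply/eqP; rewrite -(fmorph_eq0 s); apply/eqP.
by left; rewrite z0 rmorph0.
Qed.

Lemma fqaut_surj s z : exists y, z = s y.
Proof.
exists (s^-1%g z).
by have /(congr1 (fun t : fqaut F => t z)) := mulgV s.
Qed.

Lemma aut_prime_element s P t :
  prime_element P t -> prime_element (aut_place s P) (s t).
Proof.
move=> Pt; apply/seteqP; split=> x.
  case=> y; rewrite Pt => -[z Oz <-] <-.
  by exists (s z); rewrite ?rmorphM //; exact/aut_place_ring.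
case=> w Ow <-; have [y wE] := fqaut_surj s w.
move: Ow; rewrite wE => /aut_place_ring Oy.
by rewrite -rmorphM; apply/aut_place_mem; rewrite Pt; exists y.
Qed.

Lemma aut_divisor_coeff s G P :
  coeff (aut_place s P) (aut_divisor s G) = coeff P G.
Proof.
rewrite /aut_divisor raddf_sum /= -[G in RHS]freeg_sumE raddf_sum /=.
apply: eq_bigr => Q _; rewrite !coeffU.
by rewrite (inj_eq (@aut_place_inj s)).
Qed.

Lemma riemann_roch_space_aut s G z : aut_divisor s G = G ->
  riemann_roch_space G (s z) -> riemann_roch_space G z.
Proof.
move=> sG /riemann_roch_spaceP Gsz; apply/riemann_roch_spaceP => P t Pt.
have := Gsz (aut_place s P) (s t) (aut_prime_element s Pt).
rewrite -{1}sG aut_divisor_coeff => Ozt; apply/(aut_place_ring s).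
by rewrite rmorphM /= fmorphXz.
Qed.

Lemma residue_aut s P z : residue (aut_place s P) (s z) = residue P z.
Proof.
congr (xget 0 _); apply/seteqP; split=> c /=.
  by rewrite -{1}(fqaut_cst (fqautP s) c) -rmorphB => /aut_place_mem.
by move=> Pz; rewrite -(fqaut_cst (fqautP s) c) -rmorphB; exact/aut_place_mem.
Qed.

Lemma residue_eq P z (c : k) : place_set P (z - cst F c) -> residue P z = c.
Proof.
move=> Pz; apply: xget_unique => // d /= Pzd; apply/eqP; rewrite -subr_eq0.
apply/negPn/negP => dc0; have [OV _] := place_ring_valuation P.
move: Pz Pzd; rewrite place_nonunit => Nc Nd.
have := vring_nonunitB OV Nc Nd.
have -> : z - cst F c - (z - cst F d) = cst F (d - c).
  by rewrite opprB addrC addrA subrK rmorphB.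
by case=> _ []; exact: vring_unit_cst.
Qed.

(** The class of [1] is a nonzero multiple [c1] of the basis vector [b 0], so
    dividing coordinates on [b 0] by [c1] gives coordinates on [1]. *)
Lemma rational_residue P z : rational_place P -> place_ring P z ->
  place_set P (z - cst F (residue P z)).
Proof.
move=> [b [Ob Pb]] Oz; have [OV _] := place_ring_valuation P.
suff [c Pc] : exists c, place_set P (z - cst F c) by rewrite (residue_eq Pc).
have [c1 [/= Pc1 _]] := Pb 1 (vring1 OV); have [c [/= Pc _]] := Pb z Oz.
rewrite !big_ord1 in Pc Pc1.
have c10 : c1 0 0 != 0.
  apply/negP => /eqP c10; move: Pc1;
    rewrite c10 rmorph0 mul0r subr0 place_nonunit.
  by case=> _ []; exact: vring_unit1.
exists (c 0 0 / c1 0 0).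
move: Pc Pc1; rewrite place_nonunit => Nc Nc1.
have -> : z - cst F (c 0 0 / c1 0 0) = (z - cst F (c 0 0) * b 0) -
   cst F (c 0 0 / c1 0 0) * (1 - cst F (c1 0 0) * b 0).
  rewrite mulrBr mulr1 mulrA -rmorphM divfK // opprB addrA.
  by rewrite subrK.
apply: vring_nonunitB => //; apply: vring_nonunitM => //; exact: vring_cst OV _.
Qed.

Lemma residue_linear P (a : k) z w : rational_place P ->
    place_ring P z -> place_ring P w ->
  residue P (cst F a * z + w) = a * residue P z + residue P w.
Proof.
move=> Pr Oz Ow; have [OV _] := place_ring_valuation P.
apply: residue_eq; rewrite rmorphD rmorphM.
have := rational_residue Pr Oz; have := rational_residue Pr Ow.
rewrite place_nonunit => Nw Nz.
rewrite opprD addrACA -mulrBr -[_ - cst F (residue P w)]opprK.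
apply: vring_nonunitB => //; last exact: vring_nonunitN.
by apply: vring_nonunitM => //; exact: vring_cst OV _.
Qed.

Lemma residue0 P : residue P 0 = 0.
Proof.
apply: residue_eq; rewrite rmorph0 subrr place_nonunit.
have [OV _] := place_ring_valuation P; exact: vring_nonunit0.
Qed.

End Places.

(** * Cyclic action on the evaluation points *)

Section PowersOfAutomorphism.
Variables (k : finFieldType) (F : fieldExtType (ratfun k)).

Lemma aut_place_expg (s : fqaut F) (P : place F) j :
  aut_place (s ^+ j)%g P = iter j (aut_place s) P.
Proof.
apply: place_inj; elim: j => [|j IHj]; first by rewrite /= image_id.
by rewrite expgS iterS /= -IHj /= image_comp.
Qed.

End PowersOfAutomorphism.

Lemma val_iter_ordS n (i : 'I_n) j :
  iter j (@ordS n) i = ((i + j) %% n)%N :> nat.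
Proof.
elim: j => [|j IHj]; first by rewrite addn0 modn_small.
by rewrite iterS /= IHj addnS -(addn1 (_ %% _)) modnDml addn1.
Qed.

Lemma has_order_exists (gT : groupType) (g : gT) m :
  (0 < m)%N -> (g ^+ m)%g = 1%g -> exists d, has_order g d.
Proof.
move=> m_gt0 gm.
have ex : exists j, (0 < j)%N && ((g ^+ j)%g == 1%g) by exists m;
  rewrite m_gt0 gm /=.
case: (ex_minnP ex) => d /andP[d_gt0 /eqP gd] d_min; exists d;
  split=> // j j_gt0 gj.
by apply: d_min; rewrite j_gt0 gj /=.
Qed.

Theorem lemma2p2 (k : finFieldType) (F : fieldExtType (ratfun k))
    (hF : full_constant_field F) (n : nat) (n_gt0 : (0 < n)%N)
    (P : 'I_n -> place F) (P_inj : injective P)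
    (P_rat : forall i, rational_place (P i))
    (D G : divisor F) (D_def : D = (\sum_(i < n) << P i >>)%R)
    (DG_disj : disjoint_support D G)
    (s : fqaut F) (s_DG : autDG D G s)
    (s_P : forall i, aut_place s (P i) = P (ordS i)) :
  [/\ cyclic_code (AGcode P G),
      exists m : nat, has_order s m /\ (n %| m)%N,
      aut_place (s ^+ n)%g (P (Ordinal n_gt0)) = P (Ordinal n_gt0)
    & forall j : nat, (0 < j)%N ->
        aut_place (s ^+ j)%g (P (Ordinal n_gt0)) = P (Ordinal n_gt0) ->
        (n <= j)%N].
Proof.
have sG := s_DG.2.
have s_jP j i : aut_place (s ^+ j)%g (P i) = P (iter j (@ordS n) i).
  by rewrite aut_place_expg; elim: j => //= j ->.
have fix_P0 j : aut_place (s ^+ j)%g (P (Ordinal n_gt0)) = P (Ordinal n_gt0) <->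
    (n %| j)%N.
  rewrite s_jP; split=> [/P_inj/(congr1 val)|nj].
    by rewrite /= val_iter_ordS add0n => /eqP.
  by congr P; apply: val_inj; rewrite /= val_iter_ordS add0n; exact/eqP.
have P_notin_G i : P i \notin dom G.
  apply: DG_disj; rewrite mem_dom D_def raddf_sum (bigD1 i) //= coeffU eqxx.
  rewrite big1 ?addr0 // => j ji; rewrite coeffU (inj_eq P_inj) (negPf ji).
  by rewrite mulr0.
have OG z i : riemann_roch_space G z -> place_ring (P i) z.
  move=> /riemann_roch_spaceP Gz; have [t Pt] := prime_element_exists (P i).
  by have := Gz _ _ Pt; rewrite (coeff_outdom (P_notin_G i)) mulr1.
split; last 1 first.
- by move=> j j_gt0 /fix_P0; exact: dvdn_leq.
- split; first split.
  + exists 0; first by left.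
    by apply/rowP=> i; rewrite !mxE residue0.
  + move=> a _ _ [z Gz <-] [w Gw <-]; exists (cst F a * z + w).
      exact: riemann_roch_space_linear.
    by apply/rowP=> i; rewrite !mxE residue_linear //; exact: OG.
  move=> _ [z Gz <-]; have [y zE] := fqaut_surj s z.
  exists y; first by apply: (riemann_roch_space_aut sG); rewrite -zE.
  by apply/rowP=> i; rewrite !mxE -s_P zE residue_aut.
- have [m m_gt0 sm] := fqaut_finite_order s.
  have [d sd] := has_order_exists m_gt0 sm; exists d; split=> //.
  case: sd => _ sd1 _; apply/fix_P0; rewrite sd1.
  exact: (aut_place_expg s _ 0).
- exact/fix_P0.
Qed.
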